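(* Let $\mathcal{H}$ be a real Hilbert space, let $r\geq 1$, and let $A_i:\mathcal{H}\rightrightarrows\mathcal{H}$ be maximally monotone operators for $i=1,\ldots,r$. Let $\gamma>0$ and let $(\lambda_n)_{n=0}^\infty$ be a sequence in $[0,1]$ with $\sum_{n\geq0}\lambda_n(1-\lambda_n)=+\infty$. Let $\beta\in{]0,1[}$ and suppose $q\in\operatorname{ran}\left(\operatorname{Id}+\frac{\gamma}{2r(1-\beta)}\sum_{i=1}^rA_i\right)$. Given $x_{1,0},\ldots,x_{r,0}\in\mathcal{H}$, define for $n=0,1,2,\ldots$ \[ p_n=\frac{1}{r}\sum_{i=1}^r x_{i,n},\qquad x_{i,n+1}=(1-\lambda_n)x_{i,n}+\lambda_n\left(2\beta J_{(\gamma(A_i)_{-q})}-\operatorname{Id}\right)\left(2\beta p_n-x_{i,n}\right),\quad i=1,\ldots,r. \] Then: (i) $(x_{i,n+1}-x_{i,n})_{n=0}^\infty$ converges strongly to $0$ for all $i$; (ii) for each $i$, $(x_{i,n})_{n=0}^\infty$ converges weakly to some $x_i^\star\in\mathcal{H}$, and $q+\frac{1}{r}\sum_{i=1}^r x_i^\star=J_{\frac{\gamma}{2r(1-\beta)}\sum_{i=1}^rA_i}(q)$; (iii) $(q+p_n)_{n=0}^\infty$ converges strongly to $J_{\frac{\gamma}{2r(1-\beta)}\sum_{i=1}^rA_i}(q)$.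
   Context: For an operator $T:\mathcal{H}\rightrightarrows\mathcal{H}$, the resolvent is $J_T:=(\operatorname{Id}+T)^{-1}$; for maximally monotone $T$ it is single-valued with full domain. For $w\in\mathcal{H}$, the inner $w$-perturbation is $T_w(x):=T(x-w)$; thus $\gamma(A_i)_{-q}$ denotes $x\mapsto\gamma A_i(x+q)$. $\operatorname{ran}$ denotes the range. *)

(* Defs.v *)
From HB Require Import structures.
From mathcomp Require Import all_boot all_order all_algebra.
From mathcomp Require Import all_classical all_reals all_analysis.
Set Implicit Arguments. Unset Strict Implicit. Unset Printing Implicit Defensive.
Import Order.TTheory GRing.Theory Num.Theory.
Import numFieldNormedType.Exports.
Local Open Scope classical_set_scope.
Local Open Scope ring_scope.

(* A real Hilbert space is modelled as a complete normed space H over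
   R : realType together with an inner product inducing its norm. *)
Definition is_inner_product (R : realType) (H : normedModType R)
  (ip : H -> H -> R) : Prop :=
  [/\ (forall x y, ip x y = ip y x),
      (forall a x y z, ip (a *: x + y) z = a * ip x z + ip y z) &
      (forall x, ip x x = `|x| ^+ 2)].

Section Ops.
Context (R : realType) (H : normedModType R).

Definition monotone_op (ip : H -> H -> R) (T : H -> set H) : Prop :=
  forall x y u v, T x u -> T y v -> 0 <= ip (x - y) (u - v).

Definition maximally_monotone (ip : H -> H -> R) (T : H -> set H) : Prop :=
  monotone_op ip T /\
  forall S : H -> set H, monotone_op ip S ->
    (forall x u, T x u -> S x u) -> forall x u, S x u -> T x u.

Definition op_scale (c : R) (T : H -> set H) : H -> set H :=
  fun x => [set c *: u | u in T x].

Definition op_sum (r : nat) (T : 'I_r -> H -> set H) : H -> set H :=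
  fun x => [set v | exists u : 'I_r -> H,
                      (forall i, T i x (u i)) /\ v = \sum_(i < r) u i].

Definition op_perturb (w : H) (T : H -> set H) : H -> set H :=
  fun x => T (x - w).

Definition ran_Id_plus (T : H -> set H) : set H :=
  [set z | exists x u, T x u /\ z = x + u].

(* resolvent J_T = (Id + T)^{-1}: J_T x is a p with x - p in T p
   (single-valued and everywhere defined when T is maximally monotone). *)
Definition resolvent (T : H -> set H) (x : H) : H :=
  xget 0 [set p | T p (x - p)].

Definition weak_cvg (ip : H -> H -> R) (u : nat -> H) (l : H) : Prop :=
  forall y, (fun n => ip (u n) y) @ \oo --> ip l y.

End Ops.

(* Main.v *)
Require Import Defs.
From HB Require Import structures.
From mathcomp Require Import all_boot all_order all_algebra.
From mathcomp Require Import all_classical all_reals all_analysis.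
From mathcomp Require Import ring lra.
Import Order.TTheory GRing.Theory Num.Theory.
Import numFieldNormedType.Exports.
Local Open Scope classical_set_scope.
Local Open Scope ring_scope.

(* On the product space H^r put P z = (1/r) sum_i z_i and
   (T z)_i = (2 beta J_i - Id) (2 beta P z - z_i), J_i being the resolvent of
   gamma (A_i)_{-q}; the iteration is the Krasnosel'skii-Mann iteration of T.
   Firm nonexpansiveness of the J_i gives
     |T z - T w|^2 <= |z - w|^2 - 4 beta (1 - beta) r |P z - P w|^2,
   so T is nonexpansive.  If T z = z, then summing the inclusions
   (2 beta - 1) P z - z_i in gamma A_i (q + P z) over i shows that q + P z is
   the resolvent at q of the scaled sum; the range condition on q provides
   such a z.  Since T u_n - u_n -> 0, the displayed inequality at a fixed
   point forces P u_n to converge strongly.  Weak convergence is obtained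
   from asymptotic centers, without weak compactness.  That the J_i are
   everywhere defined is Minty's theorem, proved with the Fitzpatrick
   function; both this proof and the existence of asymptotic centers minimise
   t + |x|^2 over a closed convex set of pairs (x, t). *)

Set Implicit Arguments.
Unset Strict Implicit.

(* Completeness is stated with ip alone, so that the notion applies to the
   finite powers I -> H, which carry no norm induced by ip. *)
Record hilbert (R : realType) (V : lmodType R) (ip : V -> V -> R) : Prop := {
  ipC : forall x y, ip x y = ip y x;
  ip_linear : forall a x y z, ip (a *: x + y) z = a * ip x z + ip y z;
  ip_ge0 : forall x, 0 <= ip x x;
  ip_eq0 : forall x, ip x x = 0 -> x = 0;
  ip_complete : forall u : nat -> V,
    (forall e, 0 < e -> exists N, forall m n, (N <= m)%N -> (N <= n)%N ->
       ip (u m - u n) (u m - u n) < e) ->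
    exists l, ip (u n - l) (u n - l) @[n --> \oo] --> 0 }.

Arguments ipC {R V ip}.
Arguments ip_linear {R V ip}.
Arguments ip_ge0 {R V ip}.
Arguments ip_eq0 {R V ip}.
Arguments ip_complete {R V ip}.

(** * Inner product identities and strongly convex minimisation *)

Section HilbertTheory.
Context (R : realType) (V : lmodType R) (ip : V -> V -> R).
Hypothesis hV : hilbert ip.
Local Notation sq x := (ip x x).

Lemma ipDl x y z : ip (x + y) z = ip x z + ip y z.
Proof. by rewrite -[x]scale1r (ip_linear hV) mul1r scale1r. Qed.

Lemma ip0l z : ip 0 z = 0.
Proof. by apply: (addrI (ip 0 z)); rewrite -ipDl !addr0. Qed.

Lemma ipZl a x z : ip (a *: x) z = a * ip x z.
Proof. by rewrite -[a *: x]addr0 (ip_linear hV) ip0l addr0. Qed.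

Lemma ipNl x z : ip (- x) z = - ip x z.
Proof. by rewrite -scaleN1r ipZl mulN1r. Qed.

Lemma ipDr x y z : ip z (x + y) = ip z x + ip z y.
Proof. by rewrite !(ipC hV z) ipDl. Qed.

Lemma ipZr a x z : ip z (a *: x) = a * ip z x.
Proof. by rewrite !(ipC hV z) ipZl. Qed.

Lemma ipNr x z : ip z (- x) = - ip z x.
Proof. by rewrite !(ipC hV z) ipNl. Qed.

Lemma ip_sumr (I : finType) x (f : I -> V) :
  ip x (\sum_i f i) = \sum_i ip x (f i).
Proof.
by apply: (big_morph (ip x) (fun y z => ipDr y z x)); rewrite (ipC hV) ip0l.
Qed.

Definition ipE := (ipDl, ipDr, ipNl, ipNr, ipZl, ipZr).

Lemma sqD x y : sq (x + y) = sq x + 2 * ip x y + sq y.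
Proof. by rewrite !ipE (ipC hV y x); ring. Qed.

Lemma sqB x y : sq (x - y) = sq x - 2 * ip x y + sq y.
Proof. by rewrite sqD !ipE; ring. Qed.

Lemma sqZ a x : sq (a *: x) = a ^+ 2 * sq x.
Proof. by rewrite !ipE; ring. Qed.

Lemma sqBC x y : sq (x - y) = sq (y - x).
Proof. by rewrite -opprB !ipE; ring. Qed.

Lemma sq_midpoint x y :
  sq (2^-1 *: (x + y)) = 2^-1 * (sq x + sq y) - 4^-1 * sq (x - y).
Proof. by rewrite sqZ sqD sqB; field. Qed.

Lemma sq_convex t x y :
  sq ((1 - t) *: x + t *: y) =
  (1 - t) * sq x + t * sq y - t * (1 - t) * sq (x - y).
Proof. by rewrite sqD !ipE (ipC hV y x); ring. Qed.

Lemma Cauchy_Schwarz x y : ip x y ^+ 2 <= sq x * sq y.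
Proof.
have := ip_ge0 hV (sq y *: x - ip x y *: y).
have -> : sq (sq y *: x - ip x y *: y) = sq y * (sq x * sq y - ip x y ^+ 2).
  by rewrite !ipE (ipC hV y x); ring.
have := ip_ge0 hV y; rewrite le_eqVlt => /predU1P[y0 _|y0].
  by rewrite (ip_eq0 hV y (esym y0)) (ipC hV) !ip0l expr0n mulr0.
by rewrite pmulr_rge0// subr_ge0.
Qed.

Definition nrm x := Num.sqrt (sq x).

Lemma nrm_ge0 x : 0 <= nrm x. Proof. exact: sqrtr_ge0. Qed.

Lemma nrmK x : nrm x ^+ 2 = sq x.
Proof. by rewrite sqr_sqrtr// ip_ge0. Qed.

Lemma nrm_le x y : (nrm x <= nrm y) = (sq x <= sq y).
Proof. by rewrite ler_sqrt// ip_ge0. Qed.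

Lemma nrm_ip x y : `|ip x y| <= nrm x * nrm y.
Proof.
rewrite -sqrtrM ?ip_ge0// -sqrtr_sqr ler_sqrt ?mulr_ge0 ?ip_ge0//.
exact: Cauchy_Schwarz.
Qed.

Lemma nrmD x y : nrm (x + y) <= nrm x + nrm y.
Proof.
rewrite -(@ler_pXn2r _ 2)// ?nnegrE ?addr_ge0 ?nrm_ge0//.
rewrite nrmK sqD sqrrD !nrmK.
by have := le_trans (ler_norm _) (nrm_ip x y); lra.
Qed.

Lemma nrmBC x y : nrm (x - y) = nrm (y - x).
Proof. by rewrite /nrm sqBC. Qed.

Lemma nrmZ a x : nrm (a *: x) = `|a| * nrm x.
Proof. by rewrite /nrm sqZ sqrtrM ?sqr_ge0// sqrtr_sqr. Qed.

Lemma nrm_cvg0 (T : Type) (F : set_system T) {FF : Filter F} (u : T -> V) :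
  sq (u n) @[n --> F] --> 0 -> nrm (u n) @[n --> F] --> 0.
Proof.
move=> h; rewrite -(@sqrtr0 R).
by apply: (cvg_comp _ _ h); exact: sqrt_continuous.
Qed.

Lemma ip_cvgl (T : Type) (F : set_system T) {FF : Filter F} (u : T -> V) x y :
  sq (u n - x) @[n --> F] --> 0 -> ip (u n) y @[n --> F] --> ip x y.
Proof.
move=> /nrm_cvg0 h; apply/subr_cvg0.
apply: (@norm_cvg0 _ R).
have h' : nrm (u n - x) * nrm y @[n --> F] --> 0.
  by rewrite -(mul0r (nrm y)); apply: cvgM => //; exact: cvg_cst.
apply: (squeeze_cvgr _ (cvg_cst 0) h').
by apply: nearW => n; rewrite normr_ge0 -ipNl -ipDl nrm_ip.
Qed.

Lemma sq_cvg (T : Type) (F : set_system T) {FF : Filter F} (u : T -> V) x :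
  sq (u n - x) @[n --> F] --> 0 -> sq (u n) @[n --> F] --> sq x.
Proof.
move=> h.
have -> : (fun n => sq (u n)) =
    (fun n => sq (u n - x) + (2 * ip (u n) x - sq x)).
  by apply/funext => n; rewrite sqB; ring.
rewrite [X in _ --> X](_ : _ = 0 + (2 * sq x - sq x)); last by ring.
apply: (cvgD h); apply: cvgB; last exact: cvg_cst.
by apply: cvgM; [exact: cvg_cst|exact: ip_cvgl].
Qed.

(** [C] plays the role of the epigraph of a closed midpoint-convex function. Adding [sq x] makes the
    objective strongly convex: by the parallelogram identity a minimising sequence is Cauchy. *)
Lemma strong_min (C : V -> R -> Prop) (b : R) :
  (exists x t, C x t) ->
  (forall x t, C x t -> b <= t + sq x) ->
  (forall x y s t, C x s -> C y t -> C (2^-1 *: (x + y)) (2^-1 * (s + t))) ->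
  (forall (u : nat -> V) (t : nat -> R) x (t' : R), (forall n, C (u n) (t n)) ->
     sq (u n - x) @[n --> \oo] --> 0 -> t n @[n --> \oo] --> t' -> C x t') ->
  exists x t, C x t /\ forall y s, C y s -> t + sq x <= s + sq y.
Proof.
move=> [x0 [t0 C0]] Cb Cmid Ccl.
pose E := [set w | exists x t, C x t /\ w = t + sq x].
have Elb : has_lbound E by exists b => _ [x [t [Cxt ->]]]; exact: Cb.
have Einf : has_inf E by split=> //; exists (t0 + sq x0), x0, t0.
pose m := inf E.
have mle x t : C x t -> m <= t + sq x.
  by move=> Cxt; apply: ge_inf => //; exists x, t.
have /choice[u hu] (n : nat) : exists xt : V * R,
    C xt.1 xt.2 /\ xt.2 + sq xt.1 < m + n.+1%:R^-1.
  have [||w [x [t [Cxt ->]]] w_lt] := @inf_adherent _ E n.+1%:R^-1 => //.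
  by exists (x, t).
have uC n : C (u n).1 (u n).2 by have [] := hu n.
have um n : (u n).2 + sq (u n).1 < m + n.+1%:R^-1 by have [] := hu n.
have uu i j : sq ((u i).1 - (u j).1) <= 2 * (i.+1%:R^-1 + j.+1%:R^-1).
  have := mle _ _ (Cmid _ _ _ _ (uC i) (uC j)); rewrite sq_midpoint.
  have := um i; have := um j.
  move: (i.+1%:R^-1) (j.+1%:R^-1) => a c.
  by move: (sq _) (sq _) (sq _) => ? ? ?; lra.
have [|x ux] := ip_complete hV (fun n => (u n).1).
  move=> e e0.
  have e4 : 0 < e / 4 by rewrite divr_gt0.
  have /cvgrPdist_lt/(_ _ e4)[N _ hN] := @cvg_harmonic R.
  exists N => i j Ni Nj; apply: le_lt_trans (uu i j) _.
  have := hN i Ni; have := hN j Nj; rewrite /= !sub0r !normrN !ger0_norm//.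
  by rewrite /harmonic /=; move: (i.+1%:R^-1) (j.+1%:R^-1) => a c; lra.
have utm : (u n).2 + sq (u n).1 @[n --> \oo] --> m.
  have h1 : m + harmonic n @[n --> \oo] --> m.
    rewrite -[X in _ --> X]addr0.
    by apply: cvgD; [exact: cvg_cst|exact: cvg_harmonic].
  apply: (squeeze_cvgr _ (cvg_cst m) h1); apply: nearW => n.
  by rewrite mle//= ltW.
(* Only the sums [(u n).2 + sq (u n).1] are controlled, so the scalar limit is their limit [m] minus
   the limit of the squares. *)
exists x, (m - sq x); split; last by move=> y s Cys; rewrite subrK mle.
apply: (Ccl _ _ _ _ uC ux).
have -> : (fun n => (u n).2) = (fun n => (u n).2 + sq (u n).1 - sq (u n).1).
  by apply/funext => n; rewrite addrK.
by apply: cvgB => //; exact: sq_cvg ux.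
Qed.

(** First-order optimality: the minimiser is compared with points of the segment towards [(y, s)],
    close enough to make the quadratic term negligible. *)
Lemma min_variational (C : V -> R -> Prop) x t :
  (forall x y s s' a, C x s -> C y s' -> 0 <= a <= 1 ->
     C ((1 - a) *: x + a *: y) ((1 - a) * s + a * s')) ->
  C x t -> (forall y s, C y s -> t + sq x <= s + sq y) ->
  forall y s, C y s -> t - s <= 2 * ip x (y - x).
Proof.
move=> Cconv Cxt tmin y s Cys; rewrite leNgt; apply/negP => lt_ts.
pose d := t - s - 2 * ip x (y - x); pose D := sq (y - x).
have d0 : 0 < d by rewrite subr_gt0.
have D0 : 0 <= D by exact: ip_ge0.
have dD : 0 < d + D + 1 by rewrite ltr_wpDl// ltW// ltr_wpDr.
(* Minimality along the segment will give [d <= a * D], whereas [a * (d + D + 1) = d] forces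
   [a * D < d]. *)
pose a := d / (d + D + 1).
have a0 : 0 < a by rewrite divr_gt0.
have a1 : a <= 1 by rewrite ler_pdivrMr// mul1r; lra.
have : a * d <= a * (a * D).
  have a01 : 0 <= a <= 1 by rewrite ltW.
  have := tmin _ _ (Cconv _ _ _ _ _ Cxt Cys a01).
  rewrite /d /D sq_convex sqBC sqB !ipE (ipC hV y x); lra.
rewrite ler_pM2l// => le_da.
have : a * (d + D + 1) = d by rewrite divfK// gt_eqF.
have : 0 < a * d by rewrite mulr_gt0.
lra.
Qed.

End HilbertTheory.

(** * Hilbert structures on the space and on its finite powers *)

Lemma hilbert_inner_product (R : realType) (H : completeNormedModType R)
  (ip : H -> H -> R) : is_inner_product ip -> hilbert ip.
Proof.
case=> ipC ipl ipn; split=> //.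
- by move=> x; rewrite ipn sqr_ge0.
- by move=> x; rewrite ipn => /eqP; rewrite sqrf_eq0 normr_eq0 => /eqP.
move=> u hu.
have /cvg_ex[l ul] : cvg (u n @[n --> \oo]).
  apply: cauchy_cvg; apply: cauchy_exP => e e0.
  have [N hN] := hu (e ^+ 2) (exprn_gt0 _ e0).
  exists (u N); exists N => // n /= Nn.
  have := hN N n (leqnn N) Nn.
  by rewrite ipn ltr_pXn2r ?nnegrE ?normr_ge0 ?(ltW e0)// -ball_normE.
exists l; have -> : (fun n => ip (u n - l) (u n - l)) =
    (fun n => `|u n - l| * `|u n - l|) by apply/funext => n; rewrite ipn expr2.
have h : `|u n - l| @[n --> \oo] --> (0 : R).
  by rewrite -(@normr0 R H); apply: cvg_norm; apply/subr_cvg0.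
by rewrite -(mul0r 0); exact: cvgM.
Qed.

Lemma hilbert_pow (R : realType) (V : lmodType R) (ip : V -> V -> R)
  (I : finType) : hilbert ip ->
  @hilbert R (I -> V) (fun x y => \sum_i ip (x i) (y i)).
Proof.
move=> hV; split.
- by move=> x y; apply: eq_bigr => i _; exact: ipC.
- move=> a x y z; rewrite mulr_sumr -big_split/=; apply: eq_bigr => i _.
  exact: ip_linear.
- by move=> x; apply: sumr_ge0 => i _; exact: ip_ge0.
- move=> x /eqP; rewrite psumr_eq0; last by move=> i _; exact: ip_ge0.
  move=> /allP x0; apply/funext => i; apply: (ip_eq0 hV); apply/eqP.
  by apply: (x0 i); rewrite mem_index_enum.
move=> u hu.
have /choice[l ul] (i : I) :
    exists l, ip (u n i - l) (u n i - l) @[n --> \oo] --> 0.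
  apply: (ip_complete hV (fun n => u n i)) => e e0.
  have [N hN] := hu e e0; exists N => m n Nm Nn.
  apply: le_lt_trans (hN m n Nm Nn); rewrite (bigD1 i)//= lerDl.
  by apply: sumr_ge0 => j _; exact: ip_ge0.
exists l.
rewrite [X in _ --> X](_ : _ = \sum_(i : I) 0); last by rewrite big1.
by apply: cvg_big => [|i _]; [exact: add_continuous|exact: ul].
Qed.

(** * Maximally monotone operators, Minty's theorem and resolvents *)

Section Monotone.
Context (R : realType) (H : normedModType R) (ip : H -> H -> R).
Hypothesis hH : hilbert ip.
Implicit Types T : H -> set H.

(** Adjoining [(a, b)] to the graph keeps it monotone, so by maximality the pair was already
    there. *)
Lemma maximally_monotone_mem T a b : maximally_monotone ip T ->
  (forall y v, T y v -> 0 <= ip (a - y) (b - v)) -> T a b.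
Proof.
case=> mT maxT rel_ab.
apply: (maxT (fun y => [set v | T y v \/ (y = a /\ v = b)])); last by right.
  move=> y y' v v' /= [Tyv|[-> ->]] [Tyv'|[-> ->]].
  - exact: mT.
  - have := rel_ab _ _ Tyv.
    by rewrite -opprB -(opprB v) (ipNl hH) (ipNr hH) opprK.
  - exact: rel_ab.
  - by rewrite !subrr (ip0l hH).
by left.
Qed.

(** Any pair, such as [(0, 0)], is vacuously related to an empty graph, hence would belong to it. *)
Lemma maximally_monotone_nonempty T :
  maximally_monotone ip T -> exists y v, T y v.
Proof.
move=> mT; apply: contrapT => T0; apply: (T0); exists 0, 0.
by apply: maximally_monotone_mem => // y v Tyv; case: T0; exists y, v.
Qed.

(* The pair (x, u), encoded as a function on bool, minimises
   2 F(x, u) + |x|^2 + |u|^2, where F is the Fitzpatrick function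
   F(x, u) = sup { <x, v> + <y, u> - <y, v> | v in T y }.  The variational
   inequality at the minimiser says that (-u, -x) is monotonically related
   to T. *)
Lemma maximally_monotone_zero T :
  maximally_monotone ip T -> exists p, T p (- p).
Proof.
move=> mT; have [y0 [v0 T0]] := maximally_monotone_nonempty mT.
have hHH := hilbert_pow bool hH.
pose C (z : bool -> H) t := forall y v, T y v ->
  2 * (ip (z true) v + ip y (z false) - ip y v) <= t.
pose pr (y v : H) : bool -> H := fun b => if b then y else v.
have Cpr y v : T y v -> C (pr y v) (2 * ip y v).
  move=> Tyv y' v' Ty'v'; have := mT.1 _ _ _ _ Tyv Ty'v'.
  by rewrite !(ipE hH) /pr; lra.
(* Fitzpatrick's inequality [F(x, u) >= <x, u>]: if it failed, [(x, u)] would be monotonically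
   related to [T], hence in its graph, where the supremum defining [F] is at least [<x, u>]. *)
have Cge z t : C z t -> 2 * ip (z true) (z false) <= t.
  move=> Czt; rewrite leNgt; apply/negP => lt_t.
  have Tz : T (z true) (z false).
    apply: maximally_monotone_mem => // y v Tyv.
    by have := Czt _ _ Tyv; rewrite !(ipE hH); lra.
  by have := Czt _ _ Tz; lra.
have Cconv z w s t a : C z s -> C w t -> 0 <= a <= 1 ->
    C ((1 - a) *: z + a *: w) ((1 - a) * s + a * t).
  move=> Cz Cw /andP[a0 a1] y v Tyv.
  have a1' : 0 <= 1 - a by lra.
  have := ler_wpM2l a0 (Cw y v Tyv); have := ler_wpM2l a1' (Cz y v Tyv).
  rewrite !fctE !(ipE hH); lra.
have [||||z [t [Czt tmin]]] := @strong_min _ _ _ hHH C 0.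
- by exists (pr y0 v0), (2 * ip y0 v0); exact: Cpr.
- move=> z t /Cge; rewrite big_bool /=.
  by have := ip_ge0 hH (z true + z false); rewrite (sqD hH); lra.
- move=> z w s t Cz Cw.
  have -> : 2^-1 *: (z + w) = (1 - 2^-1) *: z + 2^-1 *: w.
    by rewrite scalerDr; congr (_ *: _ + _); field.
  have -> : 2^-1 * (s + t) = (1 - 2^-1) * s + 2^-1 * t by field.
  by apply: Cconv => //; lra.
- move=> u t z t' uC uz tt' y v Tyv.
  have ub b : ip (u n b - z b) (u n b - z b) @[n --> \oo] --> 0.
    apply: (squeeze_cvgr _ (cvg_cst 0) uz); apply: nearW => n.
    rewrite (ip_ge0 hH) big_bool/=.
    by case: b; rewrite ?lerDl ?lerDr; apply: (ip_ge0 hH).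
  apply: (@ler_cvg_to _ _ _ _
    (fun n => 2 * (ip (u n true) v + ip y (u n false) - ip y v)) _ _ _ _ tt');
    last by apply: nearW => n; exact: uC.
  apply: cvgM; first exact: cvg_cst.
  apply: cvgB; last exact: cvg_cst.
  apply: cvgD; first exact: ip_cvgl (ub true).
  by rewrite !(ipC hH y); under eq_cvg do rewrite (ipC hH y); apply: ip_cvgl.
pose x := z true; pose u := z false.
have related y v : T y v -> ip (x + u) (x + u) <= ip (- u - y) (- x - v).
  move=> Tyv.
  have := min_variational hHH Cconv Czt tmin (Cpr _ _ Tyv).
  have := Cge _ _ Czt; rewrite big_bool/= !fctE /pr -/x -/u !(ipE hH).
  by rewrite (ipC hH y x) (ipC hH u x); lra.
have Tux : T (- u) (- x).
  apply: maximally_monotone_mem => // y v /related; apply: le_trans.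
  exact: ip_ge0.
(* The bound [related], taken at the pair [(- u, - x)] itself, has right-hand side zero and forces
   [x = - u]. *)
have := related _ _ Tux; rewrite !subrr (ip0l hH) => xu0.
have /(ip_eq0 hH)/eqP : ip (x + u) (x + u) = 0.
  by apply/eqP; rewrite eq_le xu0 ip_ge0.
by rewrite addr_eq0 => /eqP xu; exists (- u); rewrite -xu in Tux *.
Qed.

Lemma maximally_monotone_perturb w T :
  maximally_monotone ip T -> maximally_monotone ip (op_perturb w T).
Proof.
have shift x y : x - w - (y - w) = x - y by rewrite opprB addrA subrK.
move=> mT; split.
  by move=> x y u v Tu Tv; rewrite -(shift x y); apply: mT.1 Tu Tv.
move=> S mS TS x u Sxu; apply: (maximally_monotone_mem mT) => y v Tyv.
have -> : x - w - y = x - (y + w) by rewrite opprD addrAC addrA.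
by apply: mS => //; apply: TS; rewrite /op_perturb addrK.
Qed.

Lemma monotone_scale c T : 0 <= c ->
  monotone_op ip T -> monotone_op ip (op_scale c T).
Proof.
move=> c0 mT x y _ _ [u Txu <-] [v Tyv <-].
by rewrite -scalerBr (ipZr hH) mulr_ge0//; exact: mT.
Qed.

Lemma maximally_monotone_scale c T : 0 < c ->
  maximally_monotone ip T -> maximally_monotone ip (op_scale c T).
Proof.
move=> c0 mT; split; first exact: monotone_scale (ltW c0) mT.1.
move=> S mS TS x u Sxu; exists (c^-1 *: u); last first.
  by rewrite scalerA divff ?gt_eqF// scale1r.
apply: maximally_monotone_mem => // y v Tyv.
have Scv : S y (c *: v) by apply: TS; exists v.
rewrite -(pmulr_rge0 _ c0) -(ipZr hH) scalerBr scalerA divff ?gt_eqF//.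
by rewrite scale1r; exact: mS.
Qed.

Lemma monotone_sum r (A : 'I_r -> H -> set H) :
  (forall i, monotone_op ip (A i)) -> monotone_op ip (op_sum A).
Proof.
move=> mA x y _ _ [u [Au ->]] [v [Av ->]].
rewrite -sumrB; apply: (@big_ind _ (fun z => 0 <= ip (x - y) z)).
- by rewrite (ipC hH) (ip0l hH).
- by move=> a b a0 b0; rewrite (ipDr hH) addr_ge0.
- by move=> i _; exact: mA.
Qed.

(** Translation reduces this to the previous zero problem: a solution for [T (x + z)], shifted by
    [z], is the required point. *)
Lemma Minty T z : maximally_monotone ip T -> exists p, T p (z - p).
Proof.
move=> /(maximally_monotone_perturb (- z))/maximally_monotone_zero[p].
rewrite /op_perturb opprK => Tp; exists (p + z).
by rewrite opprD addrCA subrr addr0.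
Qed.

(** Firm nonexpansiveness, phrased with inclusions instead of [resolvent], so that the case [y = y']
    also gives uniqueness of the resolvent value. *)
Lemma monotone_firm T p p' y y' : monotone_op ip T ->
  T p (y - p) -> T p' (y' - p') -> ip (p - p') (p - p') <= ip (p - p') (y - y').
Proof.
move=> mT Tp Tp'; have := mT _ _ _ _ Tp Tp'.
by rewrite !(ipE hH); lra.
Qed.

Lemma resolvent_eq T p y : monotone_op ip T -> T p (y - p) -> resolvent T y = p.
Proof.
move=> mT Tp; apply: xget_unique => // p' Tp'; apply/eqP.
rewrite -subr_eq0; apply/eqP/(ip_eq0 hH)/eqP.
rewrite eq_le (ip_ge0 hH) andbT.
by have := monotone_firm mT Tp' Tp; rewrite subrr (ipC hH) (ip0l hH).
Qed.

Lemma resolventP T y : maximally_monotone ip T ->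
  T (resolvent T y) (y - resolvent T y).
Proof. by move=> mT; apply: (xgetPex 0 (Minty y mT)). Qed.

End Monotone.

(** * Asymptotic centers of bounded sequences along a filter *)

Section AsymptoticCenter.
Context (R : realType) (V : lmodType R) (ip : V -> V -> R).
Hypothesis hV : hilbert ip.
Local Notation sq x := (ip x x).
Local Notation nrm := (nrm ip).

(* limsup_F |u n - y|^2 <= t *)
Definition asymptotic_bound (F : set_system nat) (u : nat -> V) y t :=
  forall e, 0 < e -> \forall n \near F, sq (u n - y) <= t + e.

Definition asymptotic_center F u c t :=
  asymptotic_bound F u c t /\ forall y s, asymptotic_bound F u y s -> t <= s.

Lemma asymptotic_bound_midpoint F {FF : Filter F} u x y s t :
  asymptotic_bound F u x s -> asymptotic_bound F u y t ->
  asymptotic_bound F u (2^-1 *: (x + y)) (2^-1 * (s + t) - 4^-1 * sq (x - y)).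
Proof.
move=> hx hy e e0; near=> n.
have -> : u n - 2^-1 *: (x + y) = 2^-1 *: ((u n - x) + (u n - y)).
  rewrite addrACA -opprD scalerBr -mulr2n -(scaler_nat 2 (u n)) scalerA.
  by rewrite mulVf// scale1r.
rewrite (sq_midpoint hV).
have -> : u n - x - (u n - y) = y - x by rewrite opprB addrC subrKA.
rewrite (sqBC hV y).
have : sq (u n - x) <= s + e by near: n; exact: hx.
have : sq (u n - y) <= t + e by near: n; exact: hy.
by lra.
Unshelve. all: by end_near. Qed.

(** The limsup of [sq (u n - y)] minus [sq y] is a limsup of affine functions of [y], hence convex;
    [C] is its epigraph, and minimising [t + sq y] over it minimises the limsup. *)
Lemma asymptotic_center_exists F {FF : ProperFilter F} u M :
  (forall n, nrm (u n) <= M) -> exists c t, asymptotic_center F u c t.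
Proof.
move=> uM.
have M0 : 0 <= M by apply: le_trans (uM 0); exact: nrm_ge0.
pose C y t := asymptotic_bound F u y (t + sq y).
have [||||c [t [Cc tmin]]] := @strong_min _ _ _ hV C 0.
- exists 0, (M ^+ 2) => e e0; apply: nearW => n; rewrite subr0 (ip0l hV) addr0.
  rewrite ler_wpDr ?(ltW e0)// -(nrmK hV).
  by rewrite ler_pXn2r ?nnegrE ?nrm_ge0.
- move=> x t Cxt; apply/ler_addgt0Pr => e e0.
  have [n] := filter_ex (Cxt e e0); apply: le_trans.
  exact: ip_ge0.
- move=> x y s t Cx Cy; rewrite /C (sq_midpoint hV).
  rewrite [X in asymptotic_bound _ _ _ X](_ : _ =
      2^-1 * (s + sq x + (t + sq y)) - 4^-1 * sq (x - y)).
    by apply: asymptotic_bound_midpoint.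
  by ring.
- move=> y t x t' Cy yx tt' e e0.
  have e4 : 0 < e / 4 by rewrite divr_gt0.
  have Mnrm : 2 * M * nrm (y n - x) @[n --> \oo] --> 0.
    by rewrite -(mulr0 (2 * M)); apply: cvgM; [exact: cvg_cst|exact: nrm_cvg0].
  (* Moving the center from [y k] to [x] costs [2 * ip (u n) (y k - x)], which is small uniformly in
     [n] as [u] is bounded; one index [k] therefore suffices. *)
  have [k [tk yk]] : exists k,
      `|t' - t k| < e / 4 /\ `|0 - 2 * M * nrm (y k - x)| < e / 4.
    apply: (@filter_ex _ \oo); apply: filterI.
      by move/cvgrPdist_lt : tt'; apply.
    by move/cvgrPdist_lt : Mnrm; apply.
  apply: filterS (Cy k _ e4) => n.
  have -> : sq (u n - x) =
      sq (u n - y k) + 2 * ip (u n) (y k - x) + sq x - sq (y k).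
    by rewrite !(ipE hV) !(ipC hV _ (u n)); ring.
  have := le_trans (ler_norm _) (nrm_ip hV (u n) (y k - x)).
  have := ler_wpM2r (nrm_ge0 ip (y k - x)) (uM n).
  move: tk yk; rewrite sub0r normrN !ltr_norml => /andP[tk _] /andP[_ yk].
  lra.
exists c, (t + sq c); split=> // y s hs; rewrite -(subrK (sq y) s).
by apply: tmin; rewrite /C subrK.
Qed.

(** Since [T] is nonexpansive and the residual vanishes, [T c] is as good a center as [c]; were they
    distinct, their midpoint would be strictly better. *)
Lemma asymptotic_center_fixed F {FF : ProperFilter F} u M (T : V -> V) c t :
  (forall n, nrm (u n) <= M) ->
  (forall x y, sq (T x - T y) <= sq (x - y)) ->
  sq (u n - T (u n)) @[n --> F] --> 0 ->
  asymptotic_center F u c t -> T c = c.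
Proof.
move=> uM Tne uT [cub cmin].
have Tcub : asymptotic_bound F u (T c) t.
  pose K := M + nrm (- c).
  have /cvgrPdist_lt small :
      2 * (nrm (u n - T (u n)) * K) + sq (u n - T (u n)) @[n --> F] --> 0.
    rewrite [X in _ --> X](_ : _ = 2 * (0 * K) + 0); last by ring.
    apply: cvgD; last exact: uT.
    apply: cvgM; first exact: cvg_cst.
    by apply: cvgM; [exact: nrm_cvg0|exact: cvg_cst].
  move=> e e0; have e2 : 0 < e / 2 by rewrite divr_gt0.
  near=> n.
  have : `|0 - (2 * (nrm (u n - T (u n)) * K) + sq (u n - T (u n)))| < e / 2.
    by near: n; exact: small.
  have : sq (u n - c) <= t + e / 2 by near: n; exact: cub.
  rewrite sub0r normrN ltr_norml.
  have -> : u n - T c = (u n - T (u n)) + (T (u n) - T c).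
    by rewrite addrA subrK.
  rewrite (sqD hV (u n - T (u n))); have := Tne (u n) c.
  have nK : nrm (T (u n) - T c) <= K.
    rewrite (le_trans (y := nrm (u n - c)))// ?(nrm_le hV)//.
    by rewrite (le_trans (nrmD hV _ _))// lerD2r.
  have := ler_wpM2l (nrm_ge0 ip (u n - T (u n))) nK.
  have := le_trans (ler_norm _) (nrm_ip hV (u n - T (u n)) (T (u n) - T c)).
  by move=> ? ? ? ? /andP[_ ?]; lra.
have h1 := ip_ge0 hV (c - T c).
have h2 : t <= 2^-1 * (t + t) - 4^-1 * sq (c - T c).
  by apply: cmin; apply: asymptotic_bound_midpoint.
have /(ip_eq0 hV)/eqP : sq (c - T c) = 0.
  by apply/eqP; rewrite eq_le h1 andbT; lra.
by rewrite subr_eq0 => /eqP.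
Unshelve. all: by end_near. Qed.

End AsymptoticCenter.

(** * Krasnosel'skii-Mann iteration of a nonexpansive map *)

Section KrasnoselskiiMann.
Context (R : realType) (V : lmodType R) (ip : V -> V -> R).
Hypothesis hV : hilbert ip.
Local Notation sq x := (ip x x).
Context (T : V -> V).
Hypothesis T_ne : forall x y, sq (T x - T y) <= sq (x - y).
Context (lam : nat -> R) (u : nat -> V).
Hypothesis lam01 : forall n, 0 <= lam n <= 1.
Hypothesis uS : forall n, u n.+1 = (1 - lam n) *: u n + lam n *: T (u n).

Lemma KM_fejer z n : T z = z ->
  sq (u n.+1 - z) <=
  sq (u n - z) - lam n * (1 - lam n) * sq (u n - T (u n)).
Proof.
move=> Tz; have /andP[l0 l1] := lam01 n.
have -> : u n.+1 - z = (1 - lam n) *: (u n - z) + lam n *: (T (u n) - T z).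
  by rewrite uS Tz !scalerBr addrACA -opprD -scalerDl subrK scale1r.
rewrite (sq_convex hV) Tz.
have -> : u n - z - (T (u n) - z) = u n - T (u n) by rewrite opprB addrA subrK.
have := ler_wpM2l l0 (T_ne (u n) z); rewrite Tz.
by move: (lam n * (1 - lam n) * _) => ?; lra.
Qed.

(** The new residual is [1 - lam n] times the old one plus [T (u n) - T (u n.+1)], and
    nonexpansiveness bounds the latter by the step length, [lam n] times the old residual. *)
Lemma KM_residual_nonincreasing n :
  sq (u n.+1 - T (u n.+1)) <= sq (u n - T (u n)).
Proof.
have /andP[l0 l1] := lam01 n; rewrite -(nrm_le hV).
have l1' : 0 <= 1 - lam n by rewrite subr_ge0.
have step : u n.+1 - u n = lam n *: (T (u n) - u n).
  by rewrite uS scalerBl scale1r addrAC [u n - _]addrC addrK addrC -scalerBr.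
have -> : u n.+1 - T (u n.+1) =
    (1 - lam n) *: (u n - T (u n)) + (T (u n) - T (u n.+1)).
  rewrite addrA; congr (_ - _); rewrite uS scalerBr -addrA; congr (_ + _).
  by rewrite scalerBl scale1r opprB subrK.
apply: le_trans (nrmD hV _ _) _; rewrite (nrmZ hV) ger0_norm//.
have : nrm ip (T (u n) - T (u n.+1)) <= lam n * nrm ip (u n - T (u n)).
  rewrite (le_trans (y := nrm ip (u n - u n.+1)))// ?(nrm_le hV)//.
  by rewrite (nrmBC hV (u n) (u n.+1)) step (nrmZ hV) ger0_norm// (nrmBC hV).
by lra.
Qed.

Hypothesis lam_sum : series (fun n => lam n * (1 - lam n)) @ \oo --> +oo.
Context (z0 : V).
Hypothesis Tz0 : T z0 = z0.

(** Summing [KM_fejer] bounds the weighted sum of the residuals. By monotonicity the last residual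
    times [S n] obeys the same bound, and [S n] diverges. *)
Lemma KM_residual : sq (u n - T (u n)) @[n --> \oo] --> 0.
Proof.
pose S := series (fun n => lam n * (1 - lam n)).
have l0 k : 0 <= lam k * (1 - lam k).
  by have /andP[? ?] := lam01 k; rewrite mulr_ge0// subr_ge0.
have noninc m n : (m <= n)%N -> sq (u n - T (u n)) <= sq (u m - T (u m)).
  elim: n => [|n IH]; first by rewrite leqn0 => /eqP ->.
  rewrite leq_eqVlt => /predU1P[->//|/IH]; apply: le_trans.
  exact: KM_residual_nonincreasing.
have bound n : S n * sq (u n - T (u n)) <= sq (u 0 - z0).
  have : \sum_(0 <= k < n) lam k * (1 - lam k) * sq (u k - T (u k)) <=
      sq (u 0 - z0) - sq (u n - z0).
    elim: n => [|n IH]; first by rewrite big_nil subrr.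
    by rewrite big_nat_recr//=; have := KM_fejer n Tz0; lra.
  have := ip_ge0 hV (u n - z0).
  suff : S n * sq (u n - T (u n)) <=
      \sum_(0 <= k < n) lam k * (1 - lam k) * sq (u k - T (u k)) by lra.
  rewrite /S /series /= mulr_suml !big_nat; apply: ler_sum => k /= kn.
  by rewrite ler_wpM2l// noninc// ltnW.
apply/cvgrPdist_lt => e e0; near=> n.
rewrite sub0r normrN ger0_norm ?ip_ge0//.
have Sn : (sq (u 0 - z0) + 1) / e < S n.
  by near: n; move/cvgryPgt : lam_sum; apply.
have Sn0 : 0 < S n.
  by apply: le_lt_trans Sn; rewrite divr_ge0 ?addr_ge0 ?(ip_ge0 hV)// ltW.
rewrite -(ltr_pM2l Sn0); apply: le_lt_trans (bound n) _.
by move: Sn; rewrite ltr_pdivrMr//; lra.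
Unshelve. all: by end_near. Qed.

Lemma KM_fejer_cvg z : T z = z ->
  exists l : R, sq (u n - z) @[n --> \oo] --> l.
Proof.
move=> Tz; exists (limn (fun n => sq (u n - z))).
apply: nonincreasing_is_cvgn; last first.
  by exists 0 => _ [n _ <-]; exact: ip_ge0.
apply/nonincreasing_seqP => n; apply: le_trans (KM_fejer n Tz) _.
rewrite gerBl mulr_ge0 ?(ip_ge0 hV)//.
by have /andP[? ?] := lam01 n; rewrite mulr_ge0// subr_ge0.
Qed.

Lemma KM_bounded : exists M, forall n, nrm ip (u n) <= M.
Proof.
exists (nrm ip (u 0 - z0) + nrm ip z0) => n.
rewrite -[u n](subrK z0); apply: le_trans (nrmD hV _ _) _.
rewrite lerD2r (nrm_le hV).
elim: n => // n; apply: le_trans; apply: le_trans (KM_fejer n Tz0) _.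
rewrite gerBl mulr_ge0 ?(ip_ge0 hV)//.
by have /andP[? ?] := lam01 n; rewrite mulr_ge0// subr_ge0.
Qed.

(** Both vectors are bounded and differ by the vanishing residual. For the operator on the product
    space this gap controls the distance between the means. *)
Lemma KM_gap z : T z = z ->
  sq (u n - z) - sq (T (u n) - z) @[n --> \oo] --> 0.
Proof.
move=> Tz; have [M uM] := KM_bounded; pose K := M + nrm ip (- z).
have rK : 2 * (nrm ip (u n - T (u n)) * K) @[n --> \oo] --> 0.
  rewrite [X in _ --> X](_ : _ = 2 * (0 * K)); last by ring.
  apply: cvgM; first exact: cvg_cst.
  by apply: cvgM; [exact: nrm_cvg0 KM_residual|exact: cvg_cst].
apply: (squeeze_cvgr _ (cvg_cst 0) rK); apply: nearW => n.
have Tun : T (u n) - z = (u n - z) - (u n - T (u n)).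
  by rewrite [RHS]addrC opprB addrA subrK.
have := T_ne (u n) z; rewrite Tz => Tuz.
rewrite subr_ge0 Tuz/= Tun (sqB hV (u n - z)) (ipC hV (u n - z)).
have nK : nrm ip (u n - z) <= K.
  by rewrite (le_trans (nrmD hV _ _))// lerD2r.
have := ler_wpM2l (nrm_ge0 ip (u n - T (u n))) nK.
have := le_trans (ler_norm _) (nrm_ip hV (u n - T (u n)) (u n - z)).
have := ip_ge0 hV (u n - T (u n)).
by lra.
Qed.

(* Every filter finer than \oo has its asymptotic center in Fix T, where
   lim |u n - z| exists; hence all of these centers coincide with the
   center c of u itself.  If <u n - c, y> did not become smaller than e,
   then along the filter of the indices where it is at least e a point
   c + s y would be a better center than c. *)
Lemma KM_weak : exists c, T c = c /\
  forall y, ip (u n) y @[n --> \oo] --> ip c y.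
Proof.
have [M uM] := KM_bounded.
have [c [t cC]] := asymptotic_center_exists hV uM (F := \oo).
have [cub cmin] := cC.
have Tc : T c = c.
  exact: (asymptotic_center_fixed (F := \oo) hV uM T_ne KM_residual cC).
exists c; split=> //.
have [l ul] := KM_fejer_cvg Tc.
have ubP z (F : set_system nat) (s : R) : F --> \oo ->
    sq (u n - z) @[n --> \oo] --> s -> asymptotic_bound ip F u z s.
  move=> Foo /cvgrPdist_lt us e e0; apply: Foo; apply: filterS (us e e0) => n.
  by rewrite ltr_norml => /andP[? _]; lra.
have lt_t : l <= t.
  apply/ler_addgt0Pr => e e0; apply: ler_cvg_to ul (cvg_cst (t + e)) _.
  exact: cub.
have small y e : 0 < e -> \forall n \near \oo, ip (u n - c) y < e.
  move=> e0; apply: contrapT => nsmall.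
  pose F := within [set n | e <= ip (u n - c) y] \oo.
  have FF : ProperFilter F.
    apply: Build_ProperFilter_ex => P PF; apply: contrapT => P0; apply: nsmall.
    move: PF; rewrite /F /within/=; apply: filterS => n Pn.
    rewrite ltNge; apply/negP => /Pn Pn'.
    by apply: P0; exists n.
  have Foo : F --> \oo by exact: cvg_within.
  have [c' [t' cC']] := asymptotic_center_exists hV uM (F := F).
  have [c'ub c'min] := cC'.
  have Tc' : T c' = c'.
    apply: (asymptotic_center_fixed (F := F) hV uM T_ne _ cC').
    exact: cvg_trans (cvg_app _ Foo) KM_residual.
  have [l' ul'] := KM_fejer_cvg Tc'.
  have : l' <= t'.
    have ul'F : sq (u n - c') @[n --> F] --> l'.
      exact: cvg_trans (cvg_app _ Foo) ul'.
    apply/ler_addgt0Pr => d d0; apply: ler_cvg_to ul'F (cvg_cst (t' + d)) _.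
    exact: c'ub.
  have : t <= l' by apply: cmin; apply: (ubP _ _ _ _ ul').
  have y1 : 0 < sq y + 1 by rewrite ltr_wpDl// (ip_ge0 hV).
  (* With this [s], [- 2 * (s * e) + s ^+ 2 * sq y] equals [- s * e - s ^+ 2], which is negative;
     the contradiction is [t' < l <= t <= l' <= t']. *)
  pose s := e / (sq y + 1).
  have s0 : 0 < s by rewrite divr_gt0.
  have sy : s * (sq y + 1) = e by rewrite divfK// gt_eqF.
  have : t' <= l - 2 * (s * e) + s ^+ 2 * sq y.
    apply: (c'min (c + s *: y)) => d d0.
    have Fe : F [set n | e <= ip (u n - c) y] by exact: withinT.
    apply: filterS2 _ Fe (ubP _ _ _ Foo ul d d0) => n /= ne ud.
    have -> : u n - (c + s *: y) = (u n - c) - s *: y by rewrite opprD addrA.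
    rewrite (sqB hV (u n - c)) (sqZ hV) (ipZr hV).
    by have := ler_wpM2l (ltW s0) ne; lra.
  have : 0 < s * e by rewrite mulr_gt0.
  have : s ^+ 2 * sq y = s * e - s ^+ 2 by rewrite -sy; ring.
  by have := sqr_ge0 s; lra.
move=> y; apply/cvgrPdist_lt => e e0; near=> n.
rewrite ltr_norml -(ltrN2 e); apply/andP; split.
  have : ip (u n - c) y < e by near: n; exact: small.
  by rewrite !(ipE hV); lra.
have : ip (u n - c) (- y) < e by near: n; exact: small.
by rewrite !(ipE hV); lra.
Unshelve. all: by end_near. Qed.

End KrasnoselskiiMann.

Lemma inner_product_cvg0 (R : realType) (H : normedModType R)
  (ip : H -> H -> R) (u : nat -> H) : is_inner_product ip ->
  ip (u n) (u n) @[n --> \oo] --> 0 -> u n @[n --> \oo] --> (0 : H).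
Proof.
case=> _ _ ipn u0; apply: norm_cvg0.
have -> : (fun n => `|u n|) = (fun n => nrm ip (u n)).
  by apply/funext => n; rewrite /nrm ipn sqrtr_sqr normr_id.
exact: nrm_cvg0.
Qed.

(** * The product-space operator and its fixed points *)

Section ModifiedReflections.
Context (R : realType) (H : completeNormedModType R) (ip : H -> H -> R).
Hypothesis hH : hilbert ip.
Local Notation sq x := (ip x x).
Context (r : nat) (A : 'I_r -> H -> set H) (gamma beta : R) (q : H).
Hypothesis r_gt0 : (0 < r)%N.
Hypothesis hA : forall i, maximally_monotone ip (A i).
Hypothesis gamma_gt0 : 0 < gamma.
Hypothesis beta01 : 0 < beta < 1.

Local Notation ipS := (fun x y : 'I_r -> H => \sum_i ip (x i) (y i)).
Local Notation B i := (op_scale gamma (op_perturb (- q) (A i))).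
Local Notation S := (op_scale (gamma / (2 * r%:R * (1 - beta))) (op_sum A)).

Definition mean (z : 'I_r -> H) : H := r%:R^-1 *: \sum_(i < r) z i.

(** This is [2 beta P - Id] for P the orthogonal projection onto the diagonal of the product
    space. *)
Definition reflect_mean (z : 'I_r -> H) i := 2 * beta *: mean z - z i.

Definition aamr (z : 'I_r -> H) i :=
  (2 * beta) *: resolvent (B i) (reflect_mean z i) - reflect_mean z i.

Let r0 : r%:R != 0 :> R. Proof. by rewrite pnatr_eq0 -lt0n. Qed.

Let beta0 : 0 < beta. Proof. by have /andP[] := beta01. Qed.

Let beta1 : 0 < 1 - beta.
Proof. by rewrite subr_gt0; have /andP[] := beta01. Qed.

Let maxB i : maximally_monotone ip (B i).
Proof.
by apply: maximally_monotone_scale => //; exact: maximally_monotone_perturb.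
Qed.

Let sum_mean z : \sum_(i < r) z i = r%:R *: mean z.
Proof. by rewrite scalerA divff// scale1r. Qed.

Lemma meanB z w : mean (z - w) = mean z - mean w.
Proof. by rewrite /mean -scalerBr -sumrB. Qed.

Lemma reflect_meanB z w i :
  reflect_mean (z - w) i = reflect_mean z i - reflect_mean w i.
Proof.
by rewrite /reflect_mean meanB scalerBr !fctE !opprD !opprK addrACA.
Qed.

(** Summing the cross terms turns them into multiples of [sq (mean z)]. The deficit is what later
    yields strong convergence of the means. *)
Lemma sq_reflect_mean z :
  ipS (reflect_mean z) (reflect_mean z) =
  ipS z z - 4 * beta * (1 - beta) * r%:R * sq (mean z).
Proof.
have -> : ipS (reflect_mean z) (reflect_mean z) = \sum_(i < r)
    ((2 * beta) ^+ 2 * sq (mean z) - 4 * beta * ip (mean z) (z i) + sq (z i)).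
  apply: eq_bigr => i _; rewrite /reflect_mean (sqB hH).
  by rewrite (sqZ hH (2 * beta)) (ipZl hH (2 * beta)); ring.
rewrite big_split sumrB/= sumr_const card_ord -mulr_sumr -(ip_sumr hH).
by rewrite sum_mean (ipZr hH r%:R) -[_ *+ r]mulr_natr; ring.
Qed.

(** Expanding the square and using firmness [sq j <= ip j (y - y')] leaves the surplus
    [- 4 * beta * (1 - beta) * sq j], which is nonpositive. *)
Lemma modified_reflection_nonexpansive i y y'
  (N := fun v => (2 * beta) *: resolvent (B i) v - v) :
  sq (N y - N y') <= sq (y - y').
Proof.
set j := resolvent (B i) y - resolvent (B i) y'.
have -> : N y - N y' = (2 * beta) *: j - (y - y').
  by rewrite /N /j scalerBr !opprD !opprK addrACA.
have firm : sq j <= ip j (y - y').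
  by apply: (monotone_firm hH (maxB i).1) ; exact: (resolventP hH _ (maxB i)).
rewrite (sqB hH) (sqZ hH) (ipZl hH (2 * beta)).
have := ler_wpM2l (ltW beta0) firm.
have : 0 <= beta * (1 - beta) * sq j by rewrite !mulr_ge0 ?(ip_ge0 hH)// ltW.
by lra.
Qed.

Lemma aamr_contraction z w :
  ipS (aamr z - aamr w) (aamr z - aamr w) <=
  ipS (z - w) (z - w) - 4 * beta * (1 - beta) * r%:R * sq (mean z - mean w).
Proof.
rewrite -meanB -sq_reflect_mean; apply: ler_sum => i _.
by rewrite reflect_meanB; exact: modified_reflection_nonexpansive.
Qed.

Lemma aamr_nonexpansive z w :
  ipS (aamr z - aamr w) (aamr z - aamr w) <= ipS (z - w) (z - w).
Proof.
apply: le_trans (aamr_contraction z w) _.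
by rewrite gerBl !mulr_ge0 ?(ip_ge0 hH)// ltW.
Qed.

Let monS : monotone_op ip S.
Proof.
apply: monotone_scale => //; last first.
  by apply: monotone_sum => // i; exact: (hA i).1.
by rewrite divr_ge0 ?(ltW gamma_gt0)// !mulr_ge0// ltW.
Qed.

Let scale_coef (v : H) :
  (gamma / (2 * r%:R * (1 - beta))) *: v =
  (2 * r%:R * (1 - beta))^-1 *: (gamma *: v).
Proof. by rewrite scalerA mulrC. Qed.

Let coef_neq0 : 2 * r%:R * (1 - beta) != 0.
Proof. by rewrite !mulf_neq0// ?gt_eqF. Qed.

Lemma aamr_fixed_resolvent z : aamr z = z -> q + mean z = resolvent S q.
Proof.
move=> Tz; apply/esym/(resolvent_eq hH monS).
have /choice[v hv] i : exists v, A i (q + mean z) v /\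
    gamma *: v = (2 * beta - 1) *: mean z - z i.
  have b0 : 2 * beta != 0 by rewrite mulf_neq0// gt_eqF.
  (* Component [i] of the fixed-point equation says that [2 * beta] times the resolvent is
     [2 * beta] times [mean z]. *)
  have Jz : resolvent (B i) (reflect_mean z i) = mean z.
    apply: (scalerI b0); have := congr1 (fun f => f i) Tz; rewrite /aamr.
    by move=> /eqP; rewrite subr_eq addrC subrK => /eqP.
  have := resolventP hH (reflect_mean z i) (maxB i); rewrite Jz => -[v Av hv].
  exists v; split; first by move: Av; rewrite /op_perturb opprK addrC.
  by rewrite hv /reflect_mean scalerBl scale1r addrAC.
exists (\sum_i v i); first by exists v; split=> // i; have [] := hv i.
(* The vectors [gamma *: v i] sum to [- 2 * r * (1 - beta)] times [mean z], which explains the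
   scaling factor of the operator sum. *)
rewrite scale_coef scaler_sumr.
rewrite (eq_bigr (fun i => (2 * beta - 1) *: mean z - z i)); last first.
  by move=> i _; have [] := hv i.
rewrite sumrB (sum_mean z) sumr_const card_ord.
rewrite -(scaler_nat r ((2 * beta - 1) *: mean z)) -scalerBr.
move: (mean z) => m; rewrite -{2}[m]scale1r -scalerBl !scalerA.
rewrite opprD addrA subrr add0r -(scaleN1r m).
by congr (_ *: _); field; rewrite r0 gt_eqF.
Qed.

Lemma aamr_fixed_exists : q \in ran_Id_plus S -> exists z, aamr z = z.
Proof.
rewrite inE => -[y [_ [[_ [v [Av ->]] <-]]]]; rewrite scale_coef => qE.
pose p := y - q.
have pE : p = - ((2 * r%:R * (1 - beta))^-1 *: (gamma *: \sum_i v i)).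
  by rewrite /p qE opprD addrA subrr add0r.
have vE : gamma *: \sum_i v i = - (2 * r%:R * (1 - beta)) *: p.
  by rewrite pE scaleNr scalerN opprK scalerA divff// scale1r.
(* The inclusions satisfied by a fixed point, solved for [z i]; the formula for the sum of the [v i]
   makes [p] the mean of [z]. *)
pose z i := (2 * beta - 1) *: p - gamma *: v i; exists z.
have zp : mean z = p.
  rewrite /mean /z sumrB sumr_const card_ord.
  rewrite -(scaler_nat r ((2 * beta - 1) *: p)) -scaler_sumr vE.
  rewrite !scalerA -scalerBl scalerA.
  by rewrite -[RHS]scale1r; congr (_ *: _); field.
apply/funext => i; rewrite /aamr /reflect_mean zp.
have mE : 2 * beta *: p - z i = p + gamma *: v i.
  by rewrite /z scalerBl scale1r !opprB addrC -addrA subrK addrC.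
suff -> : resolvent (B i) (2 * beta *: p - z i) = p.
  by rewrite opprB addrC subrK.
apply: (resolvent_eq hH (maxB i).1); rewrite mE addrAC subrr add0r.
by exists (v i); rewrite // /op_perturb opprK /p subrK.
Qed.

End ModifiedReflections.

(** * Return from the product space to the sequences [x i] and [p] *)

Unset Implicit Arguments.

Theorem theorem4p3 (R : realType) (H : completeNormedModType R)
  (ip : H -> H -> R) (hip : is_inner_product ip)
  (r : nat) (hr : (1 <= r)%N) (A : 'I_r -> H -> set H)
  (hA : forall i, maximally_monotone ip (A i))
  (gamma : R) (hgamma : 0 < gamma)
  (lam : nat -> R) (hlam : forall n, 0 <= lam n <= 1)
  (hsum : series (fun n => lam n * (1 - lam n)) @ \oo --> +oo)
  (beta : R) (hbeta : 0 < beta < 1)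
  (q : H)
  (hq : q \in ran_Id_plus
          (op_scale (gamma / (2 * r%:R * (1 - beta))) (op_sum A)))
  (x : 'I_r -> nat -> H) (p : nat -> H)
  (hp : forall n, p n = r%:R^-1 *: \sum_(i < r) x i n)
  (hx : forall i n, x i n.+1 =
     (1 - lam n) *: x i n +
     lam n *: ((2 * beta) *: resolvent (op_scale gamma (op_perturb (- q) (A i)))
                                (2 * beta *: p n - x i n)
               - (2 * beta *: p n - x i n))) :
  (forall i, (fun n => x i n.+1 - x i n) @ \oo --> (0 : H)) /\
  (exists xs : 'I_r -> H,
     (forall i, weak_cvg ip (x i) (xs i)) /\
     q + r%:R^-1 *: \sum_(i < r) xs i =
       resolvent (op_scale (gamma / (2 * r%:R * (1 - beta))) (op_sum A)) q) /\
  ((fun n => q + p n) @ \oo -->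
     resolvent (op_scale (gamma / (2 * r%:R * (1 - beta))) (op_sum A)) q).
Proof.
have hH := hilbert_inner_product hip.
have hS := hilbert_pow 'I_r hH.
pose T := aamr A gamma beta q; pose u n i := x i n.
have uS n : u n.+1 = (1 - lam n) *: u n + lam n *: T (u n).
  by apply/funext => i; rewrite /u hx hp.
have Tne := aamr_nonexpansive hH q hr hA hgamma hbeta.
have [z0 Tz0] := aamr_fixed_exists hH hr hA hgamma hbeta hq.
have ures := KM_residual hS Tne hlam uS hsum Tz0.
have [xs [Txs uxs]] := KM_weak hS Tne hlam uS hsum Tz0.
have xsE := aamr_fixed_resolvent hH hr hA hgamma hbeta Txs.
have sq_le (v : 'I_r -> H) i : ip (v i) (v i) <= \sum_j ip (v j) (v j).
  by rewrite (bigD1 i)//= lerDl sumr_ge0// => j _; exact: ip_ge0.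
split; [|split].
- move=> i; apply: (inner_product_cvg0 hip).
  apply: (squeeze_cvgr _ (cvg_cst 0) ures); apply: nearW => n.
  rewrite (ip_ge0 hH)/=; apply: le_trans (sq_le _ i).
  have -> : x i n.+1 - x i n = lam n *: (T (u n) i - u n i).
    have -> : x i n.+1 = (1 - lam n) *: u n i + lam n *: T (u n) i.
      by rewrite -[LHS]/(u n.+1 i) uS.
    move: (T (u n) i) => v; rewrite scalerBl scale1r scalerBr.
    by rewrite addrAC [X in X + _]addrAC subrr add0r addrC.
  rewrite (sqZ hH) (sqBC hH) ler_piMl ?(ip_ge0 hH)//.
  by have /andP[? ?] := hlam n; rewrite exprn_ile1.
- exists xs; split=> // i y.
  (* Testing against [y] in slot [i] and zero elsewhere extracts the weak limit of component [i]. *)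
  pose e j : H := if j == i then y else 0.
  have ipe (v : 'I_r -> H) : \sum_j ip (v j) (e j) = ip (v i) y.
    rewrite (bigD1 i)//= /e eqxx big1 ?addr0// => j /negPf ->.
    by rewrite (ipC hH) (ip0l hH).
  by have := uxs e; rewrite ipe; under eq_cvg do rewrite ipe.
- rewrite -xsE; apply: cvgD; first exact: cvg_cst.
  apply/subr_cvg0/(inner_product_cvg0 hip).
  have k0 : 0 < 4 * beta * (1 - beta) * r%:R.
    by have /andP[? ?] := hbeta; rewrite !mulr_gt0 ?subr_gt0 ?ltr0n.
  (* At the fixed point [xs], [aamr_contraction] bounds the squared distance between the means by
     this gap divided by [4 * beta * (1 - beta) * r]. *)
  have gap := KM_gap hS Tne hlam uS hsum Tz0 Txs.
  have gapk : (4 * beta * (1 - beta) * r%:R)^-1 *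
      (\sum_i ip ((u n - xs) i) ((u n - xs) i) -
       \sum_i ip ((T (u n) - xs) i) ((T (u n) - xs) i)) @[n --> \oo] --> 0.
    rewrite -[X in _ --> X](mulr0 (4 * beta * (1 - beta) * r%:R)^-1).
    by apply: cvgM gap; exact: cvg_cst.
  apply: (squeeze_cvgr _ (cvg_cst 0) gapk); apply: nearW => n.
  rewrite (ip_ge0 hH)/= ler_pdivlMl//.
  have := aamr_contraction hH q hr hA hgamma hbeta (u n) xs.
  by rewrite Txs hp; rewrite /mean /u; lra.
Qed.
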